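(* Let $0<\kappa\le\aleph_0$ be a cardinal number. (1) There is a set $A_{\kappa}\subseteq{}^{\omega}2$ such that ${\sf GS}_2(A_{\kappa},n)$ is undetermined for $0<n<\kappa$, while ONE has a winning strategy in ${\sf GS}_2(A_{\kappa},\kappa)$. (2) There is a set $A_{\kappa}\subseteq{}^{\omega}\omega$ such that ${\sf GS}_{\omega}(A_{\kappa},n)$ is undetermined for $0<n<\kappa$, while ONE has a winning strategy in ${\sf GS}_{\omega}(A_{\kappa},\omega)$ which ensures that TWO wins on fewer than $\kappa$ boards. (Hence ONE has a winning strategy in ${\sf GS}_{\omega}(A_{\kappa},\kappa)$.)
   Context: Multiboard Gale-Stewart game: for cardinals $\lambda\ge 2$, $\mu\ge 1$ and a set $A\subseteq{}^{\omega}\lambda$, the game ${\sf GS}_{\lambda}(A,\mu)$ has one inning per $n<\omega$. In inning $n$ player ONE first selects $f_{2n}\in{}^{\mu}\lambda$, then player TWO responds with $f_{2n+1}\in{}^{\mu}\lambda$. The elements $\alpha<\mu$ are called boards. TWO wins on board $\alpha$ if $(f_n(\alpha):n<\omega)\notin A$. ONE wins the play $(f_n:n<\omega)$ if there is an $\alpha<\mu$ with $(f_n(\alpha):n<\omega)\in A$; otherwise (TWO wins on every board) TWO wins. A strategy of ONE ensures that TWO wins on fewer than $\kappa$ boards if in every play in which ONE follows it, the set of boards on which TWO wins has cardinality less than $\kappa$. A game is undetermined if neither player has a winning strategy. The base theory is {\sf ZFC}. *)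

(* Defs.v *)
From mathcomp Require Import all_boot.
From mathcomp Require Import all_classical.

Set Implicit Arguments.
Unset Strict Implicit.
Unset Printing Implicit Defensive.

Local Open Scope classical_set_scope.
Local Open Scope card_scope.

Definition card_lt (T U : Type) (A : set T) (B : set U) : Prop :=
  A #<= B /\ ~ (B #<= A).

(* Multiboard Gale-Stewart games GS_lambda(A, mu). The cardinals lambda and mu
   are represented by types of those cardinalities: L is the type of moves on
   one board, M the type of boards. An element of ^mu lambda is a function
   M -> L, and the payoff set A is a set of sequences nat -> L. *)

Definition play (L M : Type) : Type := nat -> M -> L.

(* A strategy, for either player, reads the finite sequence of all the moves
   made so far, by both players and on all boards, oldest first. *)
Definition strategy (L M : Type) : Type := seq (M -> L) -> (M -> L).

Definition follows_one (L M : Type) (s : strategy L M) (f : play L M) : Prop :=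
  forall n : nat, f n.*2 = s (mkseq f n.*2).

Definition follows_two (L M : Type) (s : strategy L M) (f : play L M) : Prop :=
  forall n : nat, f n.*2.+1 = s (mkseq f n.*2.+1).

Definition two_wins_on (L M : Type) (A : set (nat -> L)) (f : play L M)
    (a : M) : Prop :=
  ~ A (fun n => f n a).

Definition one_wins (L M : Type) (A : set (nat -> L)) (f : play L M) : Prop :=
  exists a : M, A (fun n => f n a).

Definition two_wins (L M : Type) (A : set (nat -> L)) (f : play L M) : Prop :=
  forall a : M, two_wins_on A f a.

Definition winning_for_one (L M : Type) (A : set (nat -> L))
    (s : strategy L M) : Prop :=
  forall f : play L M, follows_one s f -> one_wins A f.

Definition winning_for_two (L M : Type) (A : set (nat -> L))
    (s : strategy L M) : Prop :=
  forall f : play L M, follows_two s f -> two_wins A f.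

Definition one_has_winning_strategy (L : Type) (A : set (nat -> L))
    (M : Type) : Prop :=
  exists s : strategy L M, winning_for_one A s.

Definition two_has_winning_strategy (L : Type) (A : set (nat -> L))
    (M : Type) : Prop :=
  exists s : strategy L M, winning_for_two A s.

Definition undetermined (L : Type) (A : set (nat -> L)) (M : Type) : Prop :=
  ~ one_has_winning_strategy A M /\ ~ two_has_winning_strategy A M.

(* K is a type of cardinality kappa. *)
Definition ensures_two_wins_fewer (L M : Type) (A : set (nat -> L))
    (s : strategy L M) (K : Type) : Prop :=
  forall f : play L M, follows_one s f ->
    card_lt [set a : M | two_wins_on A f a] [set: K].

(* Main.v *)
From Stdlib Require Import Inverse_Image.
From HB Require Import structures.
Require Import Defs.
From mathcomp Require Import all_boot.
From mathcomp Require Import all_classical.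
From mathcomp Require Import wochoice.

Set Implicit Arguments.
Unset Strict Implicit.
Unset Printing Implicit Defensive.

Local Open Scope classical_set_scope.
Local Open Scope card_scope.

(** One set serves both parts, because the construction works over any countable
    set [L] of moves with two distinct elements.

    Let ONE [broadcast]: on each board he copies, little by little, all the moves
    that TWO makes on all boards, together with an identification of the board.
    The record of a single board then determines what TWO does on every board.

    Enumerate all strategies [t] of ONE on finitely many, but fewer than [K],
    boards.  For each [t] fix a real [x t], let TWO play [x t] on every board
    against [t], and let the payoff set consist of all sequences that are not the
    record of a board in one of these plays.  By design ONE cannot win on fewer
    than [K] boards.  Suppose now that ONE broadcasts and TWO wins on two boards
    [b], [c], so that the record of [b] occurs in the play against [t] and that
    of [c] in the play against [u].  TWO plays [x t] on [b], and this real is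
    copied onto [c], hence can be read off from the play against [u]; likewise
    with the roles exchanged.  So if [x t] is never one of the countably many
    reals copied in the play against an earlier [u], then [t = u]: the boards on
    which TWO wins all come from one [t], and since boards identify themselves,
    they are no more numerous than the boards of [t], so fewer than [K]
    ([broadcast_loses_few]).

    Such reals are chosen by recursion along a well-order of the strategies all of
    whose proper initial segments are smaller than the continuum
    ([choose_reals_fresh]).

    TWO has no winning strategy on finitely many boards since she could use it on
    each of [K] boards independently, where ONE wins
    ([two_cannot_win_if_one_can]). *)

(** * Choosing reals by transfinite recursion *)

Lemma exists_well_founded_total (T : Type) :
  exists lt : T -> T -> Prop,
    well_founded lt /\ forall t u, t <> u -> lt t u \/ lt u t.
Proof.
have [R woR] := well_ordering_principle {classic T}.
have anti : antisymmetric R.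
  move=> x y; exact: (wo_chain_antisymmetric (withinW (A := predT) woR)).
exists (fun t u => ~~ R u t); split=> [t|t u tu].
  apply: contrapT => nAt.
  have [|z [[/asboolP nAz zmin] _]] :=
    woR [pred t : {classic T} | `[< ~ Acc (fun t u => ~~ R u t) t >]].
    by exists t; apply/asboolP.
  apply: nAz; constructor => u; apply: contraNP => nAu.
  by apply: zmin; apply/asboolP.
have [Rut|] := boolP (R u t); last by left.
have [Rtu|] := boolP (R t u); last by right.
by case: tu; apply: anti; rewrite Rut Rtu.
Qed.

(** If some initial segment of a well-order maps onto [T], take the least such
    segment; a section of that map embeds [T] into it, and the order pulled back
    along this embedding has only small initial segments.  Smallness is phrased
    as the absence of a surjection because that is what the diagonal argument
    below needs. *)
Lemma exists_initial_well_order (T : Type) :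
  exists lt : T -> T -> Prop,
    [/\ well_founded lt,
        forall t u, t <> u -> lt t u \/ lt u t
      & forall t (h : T -> T), ~ (forall u, exists r, lt r t /\ h r = u)].
Proof.
have [lt [wf_lt lt_total]] := exists_well_founded_total T.
pose large t := exists h : T -> T, forall u, exists r, lt r t /\ h r = u.
have [[t0 large_t0]|no_large] := pselect (exists t, large t); last first.
  by exists lt; split=> // t h h_onto; apply: no_large; exists t, h.
have [t [h h_onto] t_min] : exists2 t, large t & forall r, lt r t -> ~ large r.
  move: t0 large_t0; apply: (well_founded_ind wf_lt) => t IHt large_t.
  have [[r [rt /IHt]]|none] := pselect (exists r, lt r t /\ large r).
    by apply.
  by exists t => // r rt large_r; apply: none; exists r.
have [s sP] := choice h_onto.
have s_lt u : lt (s u) t by case: (sP u).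
have sK u : h (s u) = u by case: (sP u).
exists (fun u v => lt (s u) (s v)); split=> [|u v uv|u g g_onto].
- exact: wf_inverse_image wf_lt.
- by apply: lt_total => suv; apply: uv; rewrite -(sK u) suv sK.
- apply: (t_min (s u) (s_lt u)); exists (g \o h) => v.
  by have [r [ru <-]] := g_onto v; exists (s r); rewrite /= sK.
Qed.

(** A sequence [y] packages countably many sequences, its slices.  The coding
    [CodeSeq.code] is used because [code [:: c; m]] exceeds [m]: ONE announces
    TWO's move of inning [m] in a strictly later inning. *)
Definition slice (L : Type) (c : nat) (y : nat -> L) : nat -> L :=
  fun m => y (CodeSeq.code [:: c; m]).

(** König's diagonal argument: for each [i], the slices number [i] of the [g r i]
    with [P r] do not exhaust the reals; take such a missed real as the slice
    number [i] of [x]. *)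
Lemma avoid_countably_many_small_families (T L : Type) (I : countType) (a : L)
    (P : set T) (g : T -> I -> nat -> L) :
  (forall h : T -> nat -> L, ~ (forall y, exists r, P r /\ h r = y)) ->
  exists x : nat -> L, forall r, P r -> forall i, x <> g r i.
Proof.
move=> P_small.
have /choice[Y YP] (i : I) :
    exists y : nat -> L, forall r, P r -> slice (pickle i) (g r i) <> y.
  apply: contrapT => no_y; apply: (P_small (fun r => slice (pickle i) (g r i))).
  move=> y; apply: contrapT => no_r; apply: no_y; exists y => r Pr ry.
  by apply: no_r; exists r.
pose x n := if CodeSeq.decode n is [:: c; m]
            then if unpickle c is Some i then Y i m else a else a.
have slice_x i : slice (pickle i) x = Y i.
  by apply/funext => m; rewrite /slice /x CodeSeq.codeK pickleK.
by exists x => r Pr i xE; apply: (YP i r Pr); rewrite -xE slice_x.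
Qed.

(** The value at [t] avoids the reals that the earlier [u] and their values [x u]
    exclude.  For distinct [t] and [u] one of the two comes first, and the
    disjunction no longer mentions the order. *)
Lemma choose_reals_fresh (T L : Type) (I : countType) (a : L)
    (d : (nat -> L) -> T) (g : T -> (nat -> L) -> I -> nat -> L) :
  (forall t, exists y, d y = t) ->
  exists x : T -> nat -> L, forall t u, t <> u ->
    (forall i, x t <> g u (x u) i) \/ (forall i, x u <> g t (x t) i).
Proof.
move=> d_onto; have [lt [wf_lt lt_total lt_init]] := exists_initial_well_order T.
pose fresh t (rec : forall r, lt r t -> nat -> L) :=
  [set y : nat -> L | forall r (rt : lt r t) i, y <> g r (rec r rt) i].
pose step t rec : nat -> L := @xget {classic nat -> L} (fun=> a) (fresh t rec).
pose x := Fix wf_lt (fun=> nat -> L) step.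
have xE t : x t = step t (fun r _ => x r).
  apply: Fix_eq => u f f' ff'; rewrite /step; congr (@xget {classic _} _ (fresh u _)).
  by apply: functional_extensionality_dep => r; apply/funext => ru; apply: ff'.
have x_fresh t u : lt u t -> forall i, x t <> g u (x u) i.
  move=> ut i; suff: fresh t (fun r _ => x r) (x t) by apply.
  rewrite xE; apply: xgetPex.
  have [h h_onto|y yP] := @avoid_countably_many_small_families T L I a
    [set r | lt r t] (fun r => g r (x r)).
    apply: (lt_init t (d \o h)) => v; have [y <-] := d_onto v.
    by have [r [rt <-]] := h_onto y; exists r.
  by exists y => r rt j; apply: yP.
by exists x => t u /lt_total[tu|ut]; [right|left]; apply: x_fresh.
Qed.

(** * Coding strategies by reals *)

Definition finite_strategy (L : Type) : Type :=
  {n : nat & strategy L 'I_n.+1}.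

(** A real [y] is read as the set of those [k] with [y k = a1]; this set codes
    the number of boards by a singleton list, and the graph of the strategy by
    lists of length two. *)
Lemma strategies_from_reals (L : countType) (a0 a1 : L) : a0 <> a1 ->
  exists d : (nat -> L) -> finite_strategy L,
    forall t, exists y, d y = t.
Proof.
move=> a01.
(* Functions on boards are turned into finite functions, which are countable. *)
pose key n (h : seq ('I_n.+1 -> L)) (j : 'I_n.+1) (l : L) :=
  CodeSeq.code [:: 0; pickle (map (fun v => [ffun i => v i]) h, j, l)].
pose size_of (y : nat -> L) := xget 0 [set n | y (CodeSeq.code [:: n]) = a1].
pose strat_of (y : nat -> L) n : strategy L 'I_n.+1 :=
  fun h j => xget a0 [set l | y (key n h j l) = a1].
exists (fun y => existT _ (size_of y) (strat_of y (size_of y))) => -[n t].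
pose y k := if `[< k = CodeSeq.code [:: n] \/
                   exists h j, k = key n h j (t h j) >] then a1 else a0.
have yP k : y k = a1 <-> k = CodeSeq.code [:: n] \/
                          exists h j, k = key n h j (t h j).
  rewrite /y; case: asboolP => kP; first by split.
  by split=> // /a01.
have key_inj h j l h' j' l' : key n h j l = key n h' j' l' ->
    [/\ h = h', j = j' & l = l'].
  move=> /(can_inj CodeSeq.codeK)[] /(pcan_inj pickleK)[] hh -> ->; split=> //.
  apply: inj_map hh => v w vw; apply/funext => i.
  by have /ffunP/(_ i) := vw; rewrite !ffunE.
exists y.
have -> : size_of y = n.
  apply: xget_unique; first by apply/yP; left.
  move=> m /yP[/(can_inj CodeSeq.codeK)[]//|[h [j]]].
  by move/(can_inj CodeSeq.codeK).
congr existT; apply/funext => h; apply/funext => j.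
apply: xget_unique; first by apply/yP; right; exists h, j.
move=> l /yP[/(can_inj CodeSeq.codeK)//|[h' [j']]].
by move=> /key_inj[-> ->].
Qed.

(** * Plays and their outcomes *)

Definition run (V : Type) (S : seq V -> V) (n : nat) : V :=
  S (iter n (fun h => rcons h (S h)) [::]).

Lemma runE (V : Type) (S : seq V -> V) (n : nat) :
  run S n = S (mkseq (run S) n).
Proof.
by congr S; elim: n => // n IHn; rewrite iterS mkseqS /run IHn.
Qed.

Definition against (L M : Type) (t : strategy L M) (x : nat -> L) : play L M :=
  run (fun h => if odd (size h) then fun=> x (size h)./2 else t h).

Lemma against_two (L M : Type) (t : strategy L M) (x : nat -> L) m b :
  against t x m.*2.+1 b = x m.
Proof.
by rewrite /against runE size_mkseq /= odd_double /= uphalf_double.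
Qed.

Lemma against_one (L M : Type) (t : strategy L M) (x : nat -> L) :
  follows_one t (against t x).
Proof. by move=> n; rewrite /against runE size_mkseq odd_double. Qed.

(** TWO answers on each board of [M] as if [t] were played in a game of its own on
    [N], in which ONE makes on all boards of [N] the move he makes on that board.
    All these games have to be run simultaneously with the one on [M], because
    ONE's moves there depend on all of TWO's. *)
Lemma two_cannot_win_if_one_can (L M N : Type) (A : set (nat -> L)) (j0 : N) :
  one_has_winning_strategy A M -> ~ two_has_winning_strategy A N.
Proof.
move=> [s s_wins] [t t_wins].
pose F := run (fun h : seq (M -> N -> L) =>
  if odd (size h) then fun a => t (map (fun v => v a) h)
  else fun a _ => s (map (fun v b => v b j0) h) a).
have Fone n a j : F n.*2 a j = s (mkseq (fun k b => F k b j0) n.*2) a.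
  by rewrite {1}/F runE size_mkseq odd_double -map_comp.
have Ftwo n a : F n.*2.+1 a = t (mkseq (fun k => F k a) n.*2.+1).
  by rewrite {1}/F runE size_mkseq /= odd_double /= -map_comp.
have [n|a Aa] := s_wins (fun k a => F k a j0).
  by apply/funext => a; rewrite Fone.
by apply: (t_wins (fun k => F k a) _ j0) => // n; rewrite Ftwo.
Qed.

(** * Broadcasting *)

(** The enumeration [e] lets a countable set of boards of any size be treated like
    the natural numbers; repetitions in it are harmless. *)
Definition broadcast (L M : Type) (a0 a1 : L) (e : nat -> M) : strategy L M :=
  fun h b => match CodeSeq.decode (size h)./2 with
             | [:: c; m] => nth (fun=> a0) h m.*2.+1 (e c)
             | [:: c] => if `[< e c = b >] then a1 else a0
             | _ => a0
             end.

Lemma broadcast_copy (L M : Type) (a0 a1 : L) (e : nat -> M) (f : play L M) b c :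
  follows_one (broadcast a0 a1 e) f ->
  slice c (fun n => f n.*2 b) = (fun m => f m.*2.+1 (e c)).
Proof.
move=> fE; apply/funext => m; have /and3P[_ mc _] := CodeSeq.ltn_code [:: c; m].
rewrite /slice fE /broadcast size_mkseq doubleK CodeSeq.codeK nth_mkseq //.
by rewrite ltn_Sdouble.
Qed.

Lemma broadcast_signature (L M : Type) (a0 a1 : L) (e : nat -> M)
    (f : play L M) b c :
  follows_one (broadcast a0 a1 e) f ->
  f (CodeSeq.code [:: c]).*2 b = if `[< e c = b >] then a1 else a0.
Proof.
by move=> fE; rewrite fE /broadcast size_mkseq doubleK CodeSeq.codeK.
Qed.

(** * The payoff set *)

(** When the record of board [p.2] in the play of [t] against [y] comes from
    a broadcast, this is what TWO plays on board number [p.1] of the broadcast.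
    The board is a natural number, made an ordinal by [inord], so that the index
    type does not depend on [t]. *)
Definition copied_real (L : Type) (t : finite_strategy L) (y : nat -> L)
    (p : nat * nat) : nat -> L :=
  slice p.1 (fun m => against (projT2 t) y m.*2 (inord p.2)).

Definition outside_prepared_defeats (L K : Type)
    (x : finite_strategy L -> nat -> L) : set (nat -> L) :=
  [set y | forall n (t : strategy L 'I_n.+1) j,
     card_lt [set: 'I_n.+1] [set: K] ->
     y <> (fun k => against t (x (existT _ n t)) k j)].

Lemma one_cannot_win_on_few_boards (L K : Type) x n :
  card_lt [set: 'I_n.+1] [set: K] ->
  ~ one_has_winning_strategy (@outside_prepared_defeats L K x) 'I_n.+1.
Proof.
move=> nK [t t_wins].
have [j] := t_wins _ (against_one t (x (existT _ n t))).
by move=> /(_ n t j nK); apply.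
Qed.

Lemma card_le_lt_trans (T U V : Type) (A : set T) (B : set U) (C : set V) :
  A #<= B -> card_lt B C -> card_lt A C.
Proof.
move=> AB [BC CB]; split; first exact: card_le_trans BC.
by move=> CA; apply: CB; apply: card_le_trans AB.
Qed.

(** The freshness of [x] makes all boards on which TWO wins arise from a single
    strategy [t]; sending such a board to the board of [t] with the same record
    is injective by [broadcast_signature]. *)
Lemma broadcast_loses_few (L K M : Type) (a0 a1 : L)
    (x : finite_strategy L -> nat -> L) (e : nat -> M) :
  a0 <> a1 -> [set: K] !=set0 -> (forall b, exists c, e c = b) ->
  (forall t u, t <> u ->
     (forall p, x t <> copied_real u (x u) p) \/
     (forall p, x u <> copied_real t (x t) p)) ->
  ensures_two_wins_fewer (outside_prepared_defeats K x) (broadcast a0 a1 e) K.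
Proof.
move=> a01 K_gt0 e_onto x_fresh f fE.
set W := (X in card_lt X _).
have WP b : W b -> exists t : finite_strategy L,
    card_lt [set: 'I_(projT1 t).+1] [set: K] /\
    exists j, forall k, f k b = against (projT2 t) (x t) k j.
  move=> Wb; apply: contrapT => none; apply: Wb => n t j nK fb; apply: none.
  by exists (existT _ n t); split=> //; exists j => k; apply: (congr1 (@^~ k) fb).
(* The real [x t] is what TWO plays on [b], and ONE copies it onto [c]. *)
have copied b c (t u : finite_strategy L) i j :
    (forall k, f k b = against (projT2 t) (x t) k i) ->
    (forall k, f k c = against (projT2 u) (x u) k j) ->
    exists p, x t = copied_real u (x u) p.
  move=> fb fc; have [q qb] := e_onto b; exists (q, nat_of_ord j).
  have -> : copied_real u (x u) (q, nat_of_ord j) = slice q (fun m => f m.*2 c).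
    by congr slice; apply/funext => m; rewrite fc inord_val.
  rewrite (broadcast_copy c q fE) qb; apply/funext => m.
  by rewrite fb against_two.
have [[b0 /WP[t [tK [j0 fb0]]]]|W0] := pselect (exists b, W b); last first.
  have -> : W = set0 by apply/seteqP; split=> // b Wb; apply: W0; exists b.
  split; first exact: card_ge0.
  by move=> /card_le0P K0; case: K_gt0 => k; rewrite K0.
apply: card_le_lt_trans tK.
have /choice[idx idxP] b : exists j, W b ->
    forall k, f k b = against (projT2 t) (x t) k j.
  have [/WP[u [_ [j fb]]]|nWb] := pselect (W b); last by exists j0.
  have [tu|/x_fresh[]] := pselect (t = u); first by subst u; exists j.
    by have [p xE] := copied _ _ _ _ _ _ fb0 fb; move/(_ p).
  by have [p xE] := copied _ _ _ _ _ _ fb fb0; move/(_ p).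
pose boards : pointedType :=
  HB.pack 'I_(projT1 t).+1 (isPointed.Build 'I_(projT1 t).+1 j0).
apply/(@pcard_injP _ boards); exists idx => b c /set_mem Wb /set_mem Wc bc.
have [q qb] := e_onto b.
(* The inning where ONE identifies board [b] tells [b] and [c] apart. *)
have := idxP c Wc (CodeSeq.code [:: q]).*2.
rewrite -bc -(idxP b Wb) !(broadcast_signature _ q fE) qb.
case: (asboolP (b = b)) => // _.
by case: (asboolP (b = c)) => // _ /esym/a01.
Qed.

Lemma fewer_boards_wins (L K M : Type) (A : set (nat -> L)) (s : strategy L M) :
  [set: K] #<= [set: M] -> ensures_two_wins_fewer A s K -> winning_for_one A s.
Proof.
move=> KM few f /few[_ nKW]; apply: contrapT => nA; apply: nKW.
have -> // : [set a | two_wins_on A f a] = setT.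
by apply/seteqP; split=> // a _ Aa; apply: nA; exists a.
Qed.

(** Broadcasting among the boards of [K], or among countably many boards, are two
    instances of the same strategy, so one payoff set works for both. *)
Lemma multiboard_set (L : countType) (a0 a1 : L) (K : Type) : a0 <> a1 ->
  [set: K] !=set0 -> [set: K] #<= [set: nat] ->
  exists A : set (nat -> L),
    [/\ forall n : nat, 0 < n -> card_lt [set: 'I_n] [set: K] ->
          undetermined A 'I_n,
        exists s : strategy L nat,
          winning_for_one A s /\ ensures_two_wins_fewer A s K
      & one_has_winning_strategy A K].
Proof.
move=> a01 K_gt0 K_count.
have [d d_onto] := strategies_from_reals a01.
have [x x_fresh] := choose_reals_fresh a0 (@copied_real L) d_onto.
have [e e_onto] : exists e : nat -> K, forall b, exists c, e c = b.
  have [k _] := K_gt0.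
  have /pcard_injP[g g_inj] := K_count.
  have /choice[e eP] c : exists a, forall b, g b = c -> a = b.
    have [[a ga]|none] := pselect (exists a, g a = c).
      by exists a => b gb; apply: g_inj; rewrite ?inE // ga gb.
    by exists k => b gb; case: none; exists b.
  by exists e => b; exists (g b); apply: eP.
pose A := outside_prepared_defeats K x.
have few := broadcast_loses_few a01 K_gt0.
have wins_K : one_has_winning_strategy A K.
  exists (broadcast a0 a1 e); apply: (@fewer_boards_wins _ K) => //.
  exact: few.
exists A; split=> // [[//|n] _ nK|].
  split; first exact: one_cannot_win_on_few_boards.
  exact: (two_cannot_win_if_one_can ord0 wins_K).
exists (broadcast a0 a1 id).
have few_nat : ensures_two_wins_fewer A (broadcast a0 a1 id) K.
  by apply: few => // b; exists b.
by split=> //; apply: fewer_boards_wins few_nat.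
Qed.

Theorem theorem29 (K : Type)
    (K_gt0 : [set: K] !=set0) (K_le_aleph0 : [set: K] #<= [set: nat]) :
  (exists A : set (nat -> 'I_2),
     (forall n : nat, 0 < n -> card_lt [set: 'I_n] [set: K] ->
        undetermined A 'I_n) /\
     one_has_winning_strategy A K) /\
  (exists A : set (nat -> nat),
     (forall n : nat, 0 < n -> card_lt [set: 'I_n] [set: K] ->
        undetermined A 'I_n) /\
     (exists s : strategy nat nat,
        winning_for_one A s /\ ensures_two_wins_fewer A s K) /\
     one_has_winning_strategy A K).
Proof.
have bits : (ord0 : 'I_2) <> ord_max by [].
have nats : 0 <> 1 by [].
split.
  by have [A [undet _ wins]] := multiboard_set bits K_gt0 K_le_aleph0; exists A.
by have [A [undet few wins]] := multiboard_set nats K_gt0 K_le_aleph0; exists A.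
Qed.
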